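(* Let $C > 1$ be a constant. There exist constants $C_1 > 0$ and $0 < \sigma \leq 1/2$ depending only on $C$ such that the following holds. Let $\mathscr{L} \in \mathrm{GL}_2(\mathbb{R})$ be a linear transformation with no real eigenvalues, and let $A$ be a finite subset of $\mathbb{R}^2$ such that \[ |A + \mathscr{L}(A)| < C|A| \] and $|A|$ is large enough (in terms of $C$). Then there is a partition $A = S \cup B$ such that all of the following hold. (1) There exist $r_1$ parallel lines $l_1, \dots, l_{r_1}$ such that \[ S = (l_1 \cup \dots \cup l_{r_1}) \cap A \quad\text{and}\quad |B| \leq C_1 (2C)^6 |A|^{1-\sigma}. \] (2) We have \[ (2C)^{1/2}|A|^{1/2} > |A \cap l_1| \geq \dots \geq |A \cap l_{r_1}| \geq |A \cap l_1|^{1/2} \geq C_1^{-1}|A|^{\sigma}. \] (3) We have \[ \frac{1}{4C^{1/2}}|A|^{1/2} \leq r_1 \leq C_1 |A|^{1-\sigma}. \] (4) There exist $r_2$ parallel lines $m_1, \dots, m_{r_2}$ such that $l_1$ and $m_1$ are not parallel, and \[ S = (m_1 \cup \dots \cup m_{r_2}) \cap S \quad\text{and}\quad (8C)^{-1} r_1 \leq r_2 \leq 8C r_1. \] (5) We have \[ |A + \mathscr{L}(A)| \geq |A|\left( \frac{r_2}{r_1} + \frac{r_1}{r_2} + 2 \right) - O(|A|^{1-\sigma}), \] where the implied constant depends only on $C$.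
   Context: For $A,B \subseteq \mathbb{R}^2$, $A+B = \{a+b : a\in A, b \in B\}$, and $\mathscr{L}(A) = \{\mathscr{L}(a) : a \in A\}$. A partition $A = S\cup B$ means $S$ and $B$ are disjoint (one may be empty) with union $A$. The lines $l_1,\dots,l_{r_1}$ are (affine) pairwise distinct and parallel to each other, and likewise $m_1,\dots,m_{r_2}$; the same lines and the same $r_1,r_2$ are meant throughout (1)--(5). The notation $X \geq Y - O(Z)$ means that there is a constant $K>0$ (here depending only on $C$) with $X \geq Y - KZ$. *)

(* Defs.v *)
From HB Require Import structures.
From mathcomp Require Import all_boot all_order all_algebra finmap.
From mathcomp Require Import all_classical all_reals all_analysis.

Set Implicit Arguments.
Unset Strict Implicit.
Unset Printing Implicit Defensive.

Import Order.TTheory GRing.Theory Num.Theory.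

Local Open Scope classical_set_scope.
Local Open Scope ring_scope.

(* The plane is 'rV[R]_2, and a matrix L acts on it by v |-> v *m L, the
   convention under which [eigenvalue] is defined in mxalgebra. *)

Definition sumset (R : realType) (A B : {fset 'rV[R]_2}) : {fset 'rV[R]_2} :=
  [fset (a + b)%R | a in A, b in B]%fset.

Definition linimage (R : realType) (L : 'M[R]_2) (A : {fset 'rV[R]_2}) :
    {fset 'rV[R]_2} :=
  [fset (a *m L)%R | a in A]%fset.

Definition line (R : realType) (p d : 'rV[R]_2) : set 'rV[R]_2 :=
  [set p + t *: d | t in [set: R]].

(* A line is parallel to itself; [parallel l m] forces l and m to be lines,
   so [parallel l l] says exactly that l is a line. *)
Definition parallel (R : realType) (l m : set 'rV[R]_2) : Prop :=
  exists d p q : 'rV[R]_2, [/\ d != 0, l = line p d & m = line q d].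

Definition parallel_lines (R : realType) (n : nat)
    (l : 'I_n -> set 'rV[R]_2) : Prop :=
  injective l /\ forall i j, parallel (l i) (l j).

(* The cardinality |A \cap l|, as a real number. *)
Definition ncap (R : realType) (A : {fset 'rV[R]_2}) (l : set 'rV[R]_2) : R :=
  #|` [fset x in A | x \in l]%fset |%:R.

(* Main.v *)
Require Import Defs.
From HB Require Import structures.
From mathcomp Require Import all_boot all_order all_algebra finmap.
From mathcomp Require Import all_classical all_reals all_analysis.
From mathcomp Require Import ring lra zify.

Set Implicit Arguments.
Unset Strict Implicit.
Unset Printing Implicit Defensive.

Import Order.TTheory GRing.Theory Num.Theory.

Local Open Scope classical_set_scope.
Local Open Scope ring_scope.

(** Why the theorem holds. Write [n] for the cardinal of [A].

    A direction with few lines. Since [|A + L A| < C n], the inequalities of Petridis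
    and Ruzsa bound all the sets [k A - j A] by constant multiples of [n]
    ([plunnecke_ruzsa]), and Ruzsa's covering argument gives a set [Y] of
    at most [k(C)] points with [D + D] inside [Y + D], where [D = A - A]
    ([ruzsa_covering]). Doubling a point of [D] again and again, and each time
    removing a point of [Y] to fall back into [D], attaches to it a word over
    [Y]. When [k(C) ^ m < |D|] two points have the same word of length [m], and
    their difference [x] satisfies: [x, 2 x, 4 x, .., 2^m x] all lie in [D - D]
    ([dyadic_differences]). Hence the multiples of [x] below [2^m] are sums of
    [2 m] points of [D]; as [D] grows polynomially, adding the whole progression
    to [A] multiplies its size by at most a power of [m]
    ([card_add_progression]). On each line along [x] that meets [A] this sum has
    at least [2^m] points, and [2^m] may be taken as a fixed power of [n]: so [A]
    lies on at most [K n ^ (1 - delta)] lines along [x] ([few_parallel_fibres]).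

    The partition. Let [a] be the largest number of points of [A] on one of these
    lines. Some line has many points, so [a >= n ^ delta / K]. A line with its image
    under [L] spans a parallelogram, as [L] has no real eigenvector; so
    [a ^ 2 < C n] ([card_fibre_square]). Adding the richest line to [A] shows that
    the number of lines is at most [C ^ 2 n / a]. Let [S] be the part of [A] on
    the lines with at least [sqrt a] points: the rest has at most
    [C ^ 2 n / sqrt a] points.

    The main term. Cover [S] by [p] lines along [x], and [L S] by [q] lines along
    [x]; pulled back by [L], the latter are lines in another direction that
    cover [S]. The Grynkiewicz-Serra inequality ([grynkiewicz_serra])
    [|S + L S| >= (|S| / p + |S| / q - 1) (p + q - 1)] expands to
    [|S| (q / p + p / q + 2)] up to small terms. Compared with [|A + L A| < C n] it
    also shows that [p] and [q] are comparable. *)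

(** * Finite sets *)

Lemma leq_card_inj (T T' : choiceType) (f : T -> T') (A : {fset T})
    (B : {fset T'}) :
  {in A &, injective f} -> {in A, forall x, f x \in B} ->
  (#|` A| <= #|` B|)%N.
Proof.
move=> fI fAB; have <- : #|` [fset f x | x in A]%fset| = #|` A|.
  exact: card_in_imfset.
by apply/fsubset_leq_card/fsubsetP => _ /imfsetP[x /= xA ->]; apply: fAB.
Qed.

Lemma card_fsetX (T T' : choiceType) (A : {fset T}) (B : {fset T'}) :
  #|` (A `*` B)%fset| = (#|` A| * #|` B|)%N.
Proof.
elim/fset1U_rect: A => [|x A xA IH].
  rewrite cardfs0 mul0n; apply/eqP; rewrite cardfs_eq0 -fsubset0.
  by apply/fsubsetP => u; rewrite in_fsetM in_fset0.
have -> : ((x |` A) `*` B = [fset (x, b) | b in B] `|` A `*` B)%fset.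
  apply/fsetP => -[u w]; rewrite in_fsetU !in_fsetM /= in_fset1U.
  apply/idP/idP => [/andP[/orP[/eqP-> wB|->->]]|/orP[/imfsetP[b /= bB [-> ->]]|]].
  - by apply/orP; left; apply/imfsetP; exists w.
  - by rewrite orbT.
  - by rewrite eqxx bB.
  - by case/andP=> -> ->; rewrite orbT.
rewrite cardfsU cardfsU1 xA mulnDl mul1n IH card_in_imfset => [|b c _ _ [] //].
suff -> : ([fset (x, b) | b in B] `&` A `*` B = fset0)%fset.
  by rewrite cardfs0 subn0.
apply/fsetP => u; rewrite in_fsetI in_fset0; apply/negbTE/negP.
by case/andP=> /imfsetP[b /= _ ->]; rewrite in_fsetM /= (negPf xA).
Qed.

Lemma fset_argmin (T : choiceType) (d : Order.disp_t) (O : orderType d)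
    (f : T -> O) (A : {fset T}) :
  A != fset0 -> exists2 x, x \in A & {in A, forall z, (f x <= f z)%O}.
Proof.
move: A; apply: fset1U_rect => [|x A _ IH]; first by rewrite eqxx.
move=> _; have [->|/IH[y yA ymin]] := eqVneq (A : {fset T}) fset0.
  exists x; first by rewrite in_fset1U eqxx.
  by move=> z; rewrite in_fset1U in_fset0 orbF => /eqP->.
have [xy|yx] := leP (f x) (f y).
  exists x; first by rewrite in_fset1U eqxx.
  move=> z; rewrite in_fset1U => /orP[/eqP->//|/ymin]; exact: le_trans.
exists y; first by rewrite in_fset1U yA orbT.
by move=> z; rewrite in_fset1U => /orP[/eqP->|/ymin//]; apply: ltW.
Qed.

Lemma sorted_enumeration (T : choiceType) (s : {fset T}) (f : T -> nat) :
  s != fset0 -> exists m (t : 'I_m.+1 -> T),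
    [/\ #|` s| = m.+1, injective t, forall c, c \in s <-> exists i, t i = c &
        forall i j : 'I_m.+1, (i <= j)%N -> (f (t j) <= f (t i))%N].
Proof.
move=> s0; pose le c e := (f e <= f c)%N; pose e := sort le s.
have [x0 _] := fset0Pn _ s0.
have se : size e = (#|` s|).-1.+1 by rewrite size_sort prednK // cardfs_gt0.
have e_uniq : uniq e by rewrite sort_uniq fset_uniq.
exists (#|` s|).-1, (fun i => nth x0 e i); split.
- by rewrite prednK // cardfs_gt0.
- move=> i j /eqP; rewrite nth_uniq // ?se ?ltn_ord // => /eqP; exact: val_inj.
- move=> c; split=> [cs|[i <-]]; last by rewrite -(mem_sort le) mem_nth // se ltn_ord.
  have ce : (index c e < (#|` s|).-1.+1)%N by rewrite -se index_mem mem_sort.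
  by exists (Ordinal ce); rewrite /= nth_index // mem_sort.
move=> i j ij; have le_total : total le by move=> c d; apply: leq_total.
have le_tr : transitive le by move=> c d d' h1 h2; apply: leq_trans h2 h1.
apply: (sorted_leq_nth le_tr (fun c => leqnn (f c)) x0 (sort_sorted le_total s)) => //;
  by rewrite inE /= -/e se ltn_ord.
Qed.

(** * Sumsets in abelian groups *)

Section SumsetsInAbelianGroups.
Variable V : zmodType.
Implicit Types A B X Y Z : {fset V}.

Definition addfs A B : {fset V} := [fset (a + b)%R | a in A, b in B]%fset.
Definition oppfs A : {fset V} := [fset (- a)%R | a in A]%fset.
Definition mulfs n A : {fset V} := iter n (addfs A) [fset (0 : V)]%fset.

Lemma addfsP A B x :
  reflect (exists a b, [/\ a \in A, b \in B & x = a + b]) (x \in addfs A B).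
Proof.
apply/(iffP idP) => [/imfset2P[a /= aA [b /= bB ->]]|[a [b [aA bB ->]]]].
  by exists a, b.
by apply/imfset2P; exists a => //; exists b.
Qed.

Lemma mem_addfs A B a b : a \in A -> b \in B -> a + b \in addfs A B.
Proof. by move=> aA bB; apply/addfsP; exists a, b. Qed.

Lemma oppfsP A x : (x \in oppfs A) = (- x \in A).
Proof.
apply/imfsetP/idP => [[a /= aA ->]|xA]; first by rewrite opprK.
by exists (- x); rewrite //= opprK.
Qed.

Lemma addfsC A B : addfs A B = addfs B A.
Proof.
by apply/fsetP => x; apply/addfsP/addfsP => -[a [b [aA bB ->]]];
  exists b, a; rewrite addrC.
Qed.

Lemma addfsA A B X : addfs A (addfs B X) = addfs (addfs A B) X.
Proof.
apply/fsetP => x; apply/addfsP/addfsP.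
  move=> [a [_ [aA /addfsP[b [c [bB cX ->]]] ->]]].
  by exists (a + b), c; rewrite mem_addfs ?addrA.
move=> [_ [c [/addfsP[a [b [aA bB ->]]] cX ->]]].
by exists a, (b + c); rewrite mem_addfs ?addrA.
Qed.

Lemma addfsAC A B X : addfs (addfs A B) X = addfs (addfs A X) B.
Proof. by rewrite -!addfsA (addfsC B). Qed.

Lemma oppfsD A B : oppfs (addfs A B) = addfs (oppfs A) (oppfs B).
Proof.
apply/fsetP => x; rewrite oppfsP; apply/addfsP/addfsP => -[a [b [aA bB E]]].
  by exists (- a), (- b); rewrite !oppfsP !opprK -opprD -E opprK.
by exists (- a), (- b); rewrite -!oppfsP -opprD -E.
Qed.

Lemma addfs0 A : addfs A [fset 0]%fset = A.
Proof.
apply/fsetP => x; apply/addfsP/idP => [[a [b [aA]]]|xA].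
  by rewrite in_fset1 => /eqP-> ->; rewrite addr0.
by exists x, 0; rewrite in_fset1 eqxx addr0.
Qed.

Lemma mulfs1 A : mulfs 1 A = A.
Proof. exact: addfs0. Qed.

Lemma addfsS A B A' B' : (A `<=` A')%fset -> (B `<=` B')%fset ->
  (addfs A B `<=` addfs A' B')%fset.
Proof.
move=> /fsubsetP sA /fsubsetP sB; apply/fsubsetP => _ /addfsP[a [b [aA bB ->]]].
by rewrite mem_addfs ?sA ?sB.
Qed.

Lemma leq_card_addfs A B : (#|` addfs A B| <= #|` A| * #|` B|)%N.
Proof.
rewrite -card_fsetX; pose f (u : V * V) := u.1 + u.2.
have -> : addfs A B = [fset f u | u in (A `*` B)%fset]%fset.
  apply/fsetP => x; apply/addfsP/imfsetP => [[a [b [aA bB ->]]]|[[a b] /=]].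
    by exists (a, b) => //=; rewrite in_fsetM /= aA.
  by rewrite in_fsetM /= => /andP[aA bB] ->; exists a, b.
exact: leq_imfset_card.
Qed.

Lemma card_addfsx A x : #|` addfs A [fset x]%fset| = #|` A|.
Proof.
apply/eqP; rewrite eqn_leq; apply/andP; split.
  by apply: leq_trans (leq_card_addfs _ _) _; rewrite cardfs1 muln1.
apply: (@leq_card_inj _ _ (fun a => a + x)) => [a b _ _|a aA]; first exact: addIr.
by rewrite mem_addfs // in_fset1.
Qed.

Lemma leq_card_addfsl A B : B != fset0 -> (#|` A| <= #|` addfs A B|)%N.
Proof.
case/fset0Pn=> b bB; rewrite -(card_addfsx A b).
by apply/fsubset_leq_card/addfsS => //; rewrite fsub1set.
Qed.

(** Ruzsa's triangle inequality. A difference [u - w] keeps its two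
    representatives, so a point [x] together with the difference can be
    recovered from the pair [(x + u, x + w)]. *)
Lemma ruzsa_triangle X A B :
  (#|` X| * #|` addfs A (oppfs B)| <= #|` addfs X A| * #|` addfs X B|)%N.
Proof.
have /choice[g gP] (d : V) : exists u : V * V, d \in addfs A (oppfs B) ->
    [/\ u.1 \in A, u.2 \in B & d = u.1 - u.2].
  have [/addfsP[a [b [aA bB dE]]]|_] := boolP (d \in addfs A (oppfs B)).
    by exists (a, - b); rewrite -oppfsP opprK.
  by exists (0, 0).
rewrite -!card_fsetX.
apply: (@leq_card_inj _ _ (fun u => (u.1 + (g u.2).1, u.1 + (g u.2).2))).
  move=> [x d] [x' d']; rewrite !in_fsetM /=.
  move=> /andP[_ /gP[_ _ dE]] /andP[_ /gP[_ _ dE']] [E1 E2].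
  have dd' : d = d'.
    have -> : d = (x + (g d).1) - (x + (g d).2) by rewrite opprD addrACA subrr add0r.
    by rewrite E1 E2 opprD addrACA subrr add0r -dE'.
  by move: E1; rewrite dd' => /addIr->.
move=> [x d]; rewrite !in_fsetM /= => /andP[xX /gP[aA bB _]].
by rewrite !mem_addfs.
Qed.

(** Petridis' inequality. Adding the points of [Z] one at a time, a new point [z]
    adds to [X + B + Z] at most the translate of [X + B] by [z] without that
    of [W + B], where [W] collects the [x] with [x + z + B] already present;
    minimality of the ratio of [X] bounds [W + B] from below. *)
Lemma petridis X B :
  (forall W, (W `<=` X)%fset ->
     (#|` addfs X B| * #|` W| <= #|` addfs W B| * #|` X|)%N) ->
  forall Z, (#|` addfs (addfs X B) Z| * #|` X| <= #|` addfs X B| * #|` addfs X Z|)%N.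
Proof.
move=> Xmin; elim/fset1U_rect => [|z Z zZ IH].
  suff -> : addfs (addfs X B) fset0 = fset0 by rewrite cardfs0 mul0n.
  by apply/fsetP => x; rewrite in_fset0; apply/negP => /addfsP[a [b []]].
pose old := addfs (addfs X B) Z.
pose W := [fset x in X | (addfs (addfs [fset x] B) [fset z] `<=` old)%fset]%fset.
have WX : (W `<=` X)%fset by apply/fsubsetP => x; rewrite !inE => /andP[].
have WB : (addfs (addfs W B) [fset z] `<=` old)%fset.
  apply/fsubsetP => _ /addfsP[_ [c [/addfsP[w [b [wW bB ->]]] cz ->]]].
  move: wW; rewrite !inE => /andP[_ /fsubsetP]; apply.
  by rewrite !mem_addfs // in_fset1.
have up : (#|` addfs (addfs X B) (z |` Z)%fset| + #|` addfs W B|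
    <= #|` old| + #|` addfs X B|)%N.
  pose XBz := addfs (addfs X B) [fset z]%fset.
  pose WBz := addfs (addfs W B) [fset z]%fset.
  have sub : (addfs (addfs X B) (z |` Z)%fset `<=` old `|` (XBz `\` WBz))%fset.
    apply/fsubsetP => _ /addfsP[s [c [sXB cz ->]]].
    rewrite in_fsetU in_fsetD; case: (boolP (_ \in old)) => //= nold.
    move: cz; rewrite in_fset1U => /orP[/eqP cE|cZ].
      have -> : s + c \in XBz by rewrite mem_addfs // in_fset1 cE.
      by rewrite andbT; apply: contra nold => /(fsubsetP WB).
    by rewrite mem_addfs in nold.
  have WBX : (WBz `<=` XBz)%fset by rewrite !addfsS.
  have := fsubset_leq_card sub; rewrite cardfsU cardfsDS // !card_addfsx.
  have := fsubset_leq_card WBX; rewrite !card_addfsx.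
  by lia.
have down : (#|` addfs X Z| + #|` X| <= #|` addfs X (z |` Z)%fset| + #|` W|)%N.
  pose Wz := addfs (X `\` W)%fset [fset z]%fset.
  have : (addfs X Z `|` Wz `<=` addfs X (z |` Z)%fset)%fset.
    rewrite fsubUset !addfsS ?fsubsetUr ?fsubsetUl ?fsubsetDl //.
  move/fsubset_leq_card; rewrite cardfsU.
  suff -> : (addfs X Z `&` Wz = fset0)%fset.
    rewrite cardfs0 card_addfsx cardfsDS //.
    by have := fsubset_leq_card WX; lia.
  apply/fsetP => y; rewrite in_fsetI in_fset0; apply/negP.
  case/andP=> yXZ /addfsP[x [c [xXW cz yE]]]; move: xXW cz.
  rewrite !inE => /andP[xW xX] /eqP cE; move: xW; rewrite xX /=.
  case/negP; apply/fsubsetP => _ /addfsP[_ [d [/addfsP[x' [b [x'x bB ->]]] dz ->]]].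
  move: x'x dz; rewrite !in_fset1 => /eqP-> /eqP->.
  case/addfsP: yXZ => x1 [z1 [x1X z1Z]]; rewrite yE cE => E.
  by rewrite addrAC E addrAC !mem_addfs.
by have := Xmin _ WX; move: up down IH; rewrite -/old; nia.
Qed.

Section Doubling.
Variables (F : realFieldType) (K : F).

(** Pluennecke's inequality for one set [X] that works for all multiples: take the
    subset of [A] with the least ratio [|X + B| / |X|] and iterate Petridis'
    inequality. *)
Lemma plunnecke_subset A B :
  A != fset0 -> #|` addfs A B|%:R <= K * #|` A|%:R ->
  exists X, [/\ X != fset0, (X `<=` A)%fset &
    forall n, #|` addfs X (mulfs n B)|%:R <= K ^+ n * #|` X|%:R].
Proof.
move=> A0 hAB.
pose f X : F := #|` addfs X B|%:R / #|` X|%:R.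
have [|X] := @fset_argmin _ _ _ f (fpowerset A `\ fset0)%fset.
  by apply/fset0Pn; exists A; rewrite !inE A0 fpowersetE fsubset_refl.
rewrite !inE fpowersetE => /andP[X0 XA] Xmin.
have cX : 0 < #|` X|%:R :> F by rewrite ltr0n cardfs_gt0.
have XB : #|` addfs X B|%:R <= K * #|` X|%:R.
  have := Xmin A; rewrite !inE A0 fpowersetE fsubset_refl => /(_ isT).
  rewrite /f ler_pdivrMr // => /le_trans; apply; rewrite ler_pM2r //.
  by rewrite ler_pdivrMr // ltr0n cardfs_gt0.
have Xpet : forall Z, (#|` addfs (addfs X B) Z| * #|` X| <=
    #|` addfs X B| * #|` addfs X Z|)%N.
  apply: petridis => W WX; have [->|W0] := eqVneq W fset0.
    by rewrite cardfs0 muln0.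
  have := Xmin W; rewrite !inE W0 fpowersetE (fsubset_trans WX) // => /(_ isT).
  rewrite /f ler_pdivrMr // mulrAC ler_pdivlMr ?ltr0n ?cardfs_gt0 //.
  by rewrite -!natrM ler_nat.
exists X; split => //; elim=> [|n IH]; first by rewrite expr0 mul1r addfs0.
rewrite -(ler_pM2r cX) /= addfsA -natrM.
apply: (le_trans (y := (#|` addfs X B| * #|` addfs X (mulfs n B)|)%N%:R)).
  by rewrite ler_nat Xpet.
rewrite natrM exprS.
have -> : K * K ^+ n * #|` X|%:R * #|` X|%:R =
  (K * #|` X|%:R) * (K ^+ n * #|` X|%:R) by ring.
by apply: ler_pM.
Qed.

(** Ruzsa's triangle inequality through the set of [plunnecke_subset], against which
    both [n B] and [m B] are controlled. *)
Lemma plunnecke_ruzsa A B n m :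
  A != fset0 -> #|` addfs A B|%:R <= K * #|` A|%:R ->
  #|` addfs (mulfs n B) (oppfs (mulfs m B))|%:R <= K ^+ (n + m) * #|` A|%:R.
Proof.
move=> A0 /(plunnecke_subset A0)[X [X0 XA Xn]].
have cX : 0 < #|` X|%:R :> F by rewrite ltr0n cardfs_gt0.
have K0 k : 0 <= K ^+ k by have := le_trans (ler0n F _) (Xn k); rewrite pmulr_lge0.
apply: (le_trans (y := K ^+ (n + m) * #|` X|%:R)); last first.
  by rewrite ler_wpM2l // ler_nat fsubset_leq_card.
rewrite -(ler_pM2l cX) -natrM.
apply: le_trans (_ : _ <= (#|` addfs X (mulfs n B)| * #|` addfs X (mulfs m B)|)%N%:R) _.
  by rewrite ler_nat ruzsa_triangle.
rewrite natrM exprD.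
have -> : #|` X|%:R * (K ^+ n * K ^+ m * #|` X|%:R) =
  (K ^+ n * #|` X|%:R) * (K ^+ m * #|` X|%:R) :> F by ring.
by apply: ler_pM.
Qed.

End Doubling.
End SumsetsInAbelianGroups.

(** * Long progressions in sets of small doubling *)

Section DyadicProgression.
Variable V : zmodType.
Implicit Types A B D T Y : {fset V}.

(** Take [Y] in [T] of the largest size such that the translates of [B] by the
    points of [Y] are disjoint: any further translate of [B] meets one of them. *)
Lemma ruzsa_covering T B k :
  B != fset0 -> (#|` addfs T B| <= k * #|` B|)%N ->
  exists Y, (#|` Y| <= k)%N /\
    {in T, forall t, exists y d,
       [/\ y \in Y, d \in addfs B (oppfs B) & t = y + d]}.
Proof.
move=> B0 TB.
pose good := [fset Y in fpowerset T | #|` addfs Y B| == (#|` Y| * #|` B|)%N]%fset.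
have [|Y] := @fset_argmin _ _ _ (fun Y => #|` T| - #|` Y|)%N good.
  apply/fset0Pn; exists fset0; rewrite !inE fpowersetE fsub0set cardfs0 mul0n.
  rewrite cardfs_eq0; apply/eqP/fsetP => x; rewrite in_fset0.
  by apply/negP => /addfsP[a [b []]].
rewrite !inE fpowersetE => /andP[YT /eqP YB] Ymax; exists Y; split.
  rewrite -(@leq_pmul2r #|` B|) ?cardfs_gt0 // -YB; apply: leq_trans TB.
  exact/fsubset_leq_card/addfsS.
move=> t tT; have [b0 b0B] := fset0Pn _ B0.
have [tY|tY] := boolP (t \in Y).
  exists t, (b0 - b0); rewrite tY subrr addr0; split => //.
  by rewrite -(subrr b0) mem_addfs // oppfsP opprK.
pose tB := addfs [fset t]%fset B.
have [|/fset0Pn[x]] := eqVneq (addfs Y B `&` tB)%fset fset0; last first.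
  rewrite in_fsetI => /andP[/addfsP[y [b [yY bB ->]]] /addfsP[c [b' [ct b'B E]]]].
  move: ct E; rewrite in_fset1 => /eqP-> E.
  exists y, (b - b'); rewrite yY mem_addfs ?oppfsP ?opprK //; split => //.
  by rewrite addrA E addrK.
move=> dis; have tYT : (t |` Y `<=` T)%fset by rewrite fsubUset fsub1set tT.
have : (t |` Y)%fset \in good.
  rewrite !inE fpowersetE tYT /= cardfsU1 tY mulnDl mul1n -YB.
  have -> : addfs (t |` Y)%fset B = (addfs Y B `|` tB)%fset.
    apply/fsetP => x; rewrite in_fsetU; apply/addfsP/orP.
      move=> [c [b [cY bB ->]]]; move: cY; rewrite in_fset1U => /orP[/eqP->|cY].
        by right; rewrite mem_addfs // in_fset1.
      by left; rewrite mem_addfs.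
    case=> /addfsP[c [b [cY bB ->]]]; exists c, b; rewrite in_fset1U.
      by rewrite cY orbT.
    by move: cY; rewrite in_fset1 => ->.
  by rewrite cardfsU dis cardfs0 subn0 /tB (addfsC [fset t]%fset) card_addfsx addnC.
move=> /Ymax; rewrite leEnat cardfsU1 tY.
have := fsubset_leq_card tYT; rewrite cardfsU1 tY.
by lia.
Qed.

(** Write [d *+ 2 = y + d'] with [y] in [Y] and [d'] in [D], and repeat with
    [d'] in place of [d]. If two points of [D] meet the same [y] in each of the
    first [m] steps, these cancel in the difference, so doubling the difference
    [i] times still gives a difference of points of [D]. The hypothesis on the
    cardinals makes two such points exist. *)
Lemma dyadic_differences D Y m :
  {in D, forall d, exists y d', [/\ y \in Y, d' \in D & d *+ 2 = y + d']} ->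
  (#|` Y| ^ m < #|` D|)%N ->
  exists2 x, x != 0 &
    forall i, (i <= m)%N -> exists a b, [/\ a \in D, b \in D & x *+ 2 ^ i = a - b].
Proof.
move=> DY cD.
have /choice[f fP] (d : V) : exists u : V * V, d \in D ->
    [/\ u.1 \in Y, u.2 \in D & d *+ 2 = u.1 + u.2].
  have [/DY[y [d' yd]]|_] := boolP (d \in D); first by exists (y, d').
  by exists (0, 0).
pose next d := (f d).2; pose orbit i d := iter i next d.
have orbitD d i : d \in D -> orbit i d \in D.
  by move=> dD; elim: i => //= i /fP[].
have /fset0Pn[d0 d0D] : D != fset0 by rewrite -cardfs_gt0; apply: leq_trans cD.
have [y0Y _ _] := fP _ d0D.
pose code (d : D) : {ffun 'I_m -> Y} :=
  [ffun i : 'I_m => insubd [` y0Y]%fset (f (orbit i (val d))).1].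
have /injectivePn[d [d' dd' cdd']] : ~~ injectiveb code.
  apply: contraL cD => /injectiveP/leq_card; rewrite card_ffun card_ord.
  by rewrite -!cardfE leqNgt.
have {}cdd' (i : nat) : (i < m)%N ->
    (f (orbit i (val d))).1 = (f (orbit i (val d'))).1.
  move=> im; have /ffunP/(_ (Ordinal im)) := cdd'; rewrite !ffunE /=.
  move/(congr1 val); rewrite !insubdK //.
    by case: (fP _ (orbitD _ i (valP d'))).
  by case: (fP _ (orbitD _ i (valP d))).
exists (val d - val d'); first by rewrite subr_eq0 (inj_eq val_inj).
move=> i im; exists (orbit i (val d)), (orbit i (val d')).
split; [exact/orbitD/valP|exact/orbitD/valP|].
elim: i im => [|i IH] im; first by rewrite expn0.
rewrite expnSr mulrnA IH ?(ltnW im) // mulrnBl.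
have [_ _ ->] := fP _ (orbitD _ i (valP d)).
have [_ _ ->] := fP _ (orbitD _ i (valP d')).
by rewrite cdd' // opprD addrACA subrr add0r.
Qed.

(** The binary digits of [j] write [x *+ j] as a sum of at most [2 * m] points of
    [D]. Each addition of a point of [D] is absorbed at the cost of one element
    of [Y], so only the multiplicities of the elements of [Y] matter, and
    these are polynomially many in [m]. *)
Lemma multiples_in_box D Y x m :
  0 \in D -> oppfs D = D ->
  {in D &, forall a b, exists y d, [/\ y \in Y, d \in D & a + b = y + d]} ->
  (forall i, (i < m)%N -> exists a b, [/\ a \in D, b \in D & x *+ 2 ^ i = a - b]) ->
  forall j, (j < 2 ^ m)%N -> exists (c : V -> nat) d,
    [/\ forall y, (c y <= 2 * m)%N, d \in D & x *+ j = \sum_(y <- Y) y *+ c y + d].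
Proof.
move=> D0 DN DY; elim: m => [|m IH] xD j.
  rewrite expn0 ltnS leqn0 => /eqP->; exists (fun=> 0%N), 0; split => //.
  by rewrite big1 // addr0.
have absorb n c d e : (forall y, (c y <= n)%N) -> d \in D -> e \in D ->
    exists (c' : V -> nat) d', [/\ forall y, (c' y <= n.+1)%N, d' \in D &
      \sum_(y <- Y) y *+ c y + d + e = \sum_(y <- Y) y *+ c' y + d'].
  move=> cn dD eD; have [z [d' [zY d'D E]]] := DY _ _ dD eD.
  exists (fun y => c y + (y == z))%N, d'; split => //.
    by move=> y; rewrite -addn1 leq_add //; case: (_ == _).
  rewrite -addrA E addrA; congr (_ + _).
  under [RHS]eq_bigr do rewrite mulrnDr.
  rewrite big_split /=; congr (_ + _).
  rewrite (bigD1_seq z) ?fset_uniq //= eqxx mulr1n big1 ?addr0 // => y /negPf->.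
  by rewrite mulr0n.
have {}IH := IH (fun i im => xD i (ltnW im)).
have [jm _|mj jS] := ltnP j (2 ^ m).
  have [c [d [cm dD E]]] := IH _ jm; exists c, d; split => // y.
  by apply: leq_trans (cm y) _; rewrite leq_mul2l leqnSn orbT.
have jm : (j - 2 ^ m < 2 ^ m)%N by move: jS; rewrite expnS; lia.
have [c [d [cm dD E]]] := IH _ jm.
have [a [b [aD bD xE]]] := xD _ (ltnSn m).
have [c1 [d1 [c1m d1D E1]]] := absorb _ _ _ _ cm dD aD.
have nbD : - b \in D by rewrite -oppfsP DN.
have [c2 [d2 [c2m d2D E2]]] := absorb _ _ _ _ c1m d1D nbD.
exists c2, d2; split => //.
  by move=> y; rewrite mulnS addnC addn2.
by rewrite -E2 -E1 -addrA -xE -E -mulrnDr subnK.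
Qed.

(** The sum lies in that of a box of combinations of [Y], whose size is polynomial
    in [m], with [A + D]; for [D = A - A] the latter is of the order of [A]. *)
Lemma card_add_progression A D Y x m :
  0 \in D -> oppfs D = D ->
  {in D &, forall a b, exists y d, [/\ y \in Y, d \in D & a + b = y + d]} ->
  (forall i, (i < m)%N -> exists a b, [/\ a \in D, b \in D & x *+ 2 ^ i = a - b]) ->
  (#|` addfs A [fset x *+ j | j in iota 0 (2 ^ m)]%fset|
     <= (2 * m).+1 ^ #|` Y| * #|` addfs A D|)%N.
Proof.
move=> D0 DN DY xD.
pose N := (2 * m)%N.
pose comb (c : {ffun Y -> 'I_N.+1}) := \sum_(y : Y) val y *+ c y.
pose box := [fset comb c | c in predT]%fset.
have boxN : (#|` box| <= N.+1 ^ #|` Y|)%N.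
  apply: leq_trans (leq_imfset_card _ _ _) _.
  by rewrite -cardE card_ffun card_ord -cardfE.
apply: leq_trans (_ : #|` addfs box (addfs A D)| <= _)%N; last first.
  by apply: leq_trans (leq_card_addfs _ _) _; rewrite leq_mul2r boxN orbT.
apply/fsubset_leq_card/fsubsetP => _ /addfsP[a [_ [aA /imfsetP[j /= jm ->] ->]]].
have [|c [d [cN dD ->]]] := multiples_in_box D0 DN DY xD (j := j).
  by move: jm; rewrite mem_iota.
rewrite addrCA mem_addfs ?mem_addfs //.
apply/imfsetP => /=; exists [ffun y : Y => inord (c (val y))] => //.
rewrite big_seq_fsetE /=; apply: eq_bigr => y _.
by rewrite ffunE inordK // ltnS cN.
Qed.

End DyadicProgression.

(** * Sumsets of sets on parallel lines *)

Section ParallelFibres.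
Variables (F : realFieldType) (V : zmodType) (phi psi : {additive V -> F}).
Hypothesis coord_inj : forall x, phi x = 0 -> psi x = 0 -> x = 0.
Implicit Types A B X Y P : {fset V}.

Definition proj A : {fset F} := [fset phi a | a in A]%fset.
Definition fibre A c : {fset V} := [fset a in A | phi a == c]%fset.

Lemma mem_proj A a : a \in A -> phi a \in proj A.
Proof. by move=> aA; apply/imfsetP; exists a. Qed.

Lemma in_fibre A c a : (a \in fibre A c) = (a \in A) && (phi a == c).
Proof. by rewrite !inE. Qed.

Lemma fibre_sub A c : (fibre A c `<=` A)%fset.
Proof. by apply/fsubsetP => a; rewrite in_fibre => /andP[]. Qed.

Lemma fibre_neq0 A c : (fibre A c != fset0) = (c \in proj A).
Proof.
apply/fset0Pn/imfsetP => [[a]|[a /= aA ->]].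
  by rewrite in_fibre => /andP[aA /eqP<-]; exists a.
by exists a; rewrite in_fibre aA eqxx.
Qed.

Lemma proj_eq0 A : (proj A == fset0) = (A == fset0).
Proof.
have [->|/fset0Pn[a aA]] := eqVneq A fset0.
  by apply/eqP/fsetP => c; rewrite in_fset0; apply/negP => /imfsetP[].
by apply/negbTE/fset0Pn; exists (phi a); apply: mem_proj.
Qed.

Lemma proj_fibreD A c : proj (A `\` fibre A c)%fset = (proj A `\ c)%fset.
Proof.
apply/fsetP => e; apply/imfsetP/idP => [[a /=]|].
  rewrite in_fsetD in_fibre => /andP[+ aA] ->; rewrite aA /= => ac.
  by rewrite in_fsetD1 ac mem_proj.
rewrite in_fsetD1 => /andP[ec /imfsetP[a /= aA E]]; exists a => //.
by rewrite in_fsetD in_fibre aA -E ec.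
Qed.

Lemma card_fibres A : #|` A| = (\sum_(c <- proj A) #|` fibre A c|)%N.
Proof.
have fibreE c : #|` fibre A c| = (\sum_(a <- A) (phi a == c))%N.
  transitivity (size [seq a <- A | phi a == c]); last first.
    by rewrite size_filter -sum1_count big_mkcond.
  apply/perm_size/uniq_perm; rewrite ?filter_uniq ?fset_uniq // => a.
  by rewrite in_fibre mem_filter andbC.
under eq_bigr do rewrite fibreE.
rewrite exchange_big /= -sum1_size !big_seq; apply: eq_bigr => a aA.
rewrite (bigD1_seq (phi a)) ?mem_proj ?fset_uniq //= eqxx big1 // => c.
by rewrite eq_sym => /negPf->.
Qed.

(** Representatives of distinct fibres stay in distinct fibres after adding
    elements of [P], so the sums with them are pairwise distinct. *)
Lemma card_proj_mul A P c :
  {in P, forall x, phi x = c} -> (#|` proj A| * #|` P| <= #|` addfs A P|)%N.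
Proof.
move=> Pc; have /choice[rep repP] (e : F) : exists a, e \in proj A ->
    a \in A /\ phi a = e.
  have [/imfsetP[a /= aA ->]|_] := boolP (e \in proj A); first by exists a.
  by exists 0.
rewrite -card_fsetX; apply: (@leq_card_inj _ _ (fun u => rep u.1 + u.2)).
  move=> [e x] [e' x']; rewrite !in_fsetM /= => /andP[/repP[_ eE] xP].
  move=> /andP[/repP[_ eE'] xP'] E.
  have := congr1 phi E; rewrite !raddfD /= eE eE' (Pc x) // (Pc x') // => /addIr ee'.
  by move: E; rewrite ee' => /addrI->.
by move=> [e x]; rewrite in_fsetM /= => /andP[/repP[aA _] xP]; apply: mem_addfs.
Qed.

(** The one-dimensional bound: [x0 + Y] and [X + y1] meet only in [x0 + y1] when
    [x0] is the least point of [X] and [y1] the greatest point of [Y]. *)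
Lemma leq_card_addfs_line X Y :
  X != fset0 -> Y != fset0 -> {in X &, injective psi} ->
  (#|` X| + #|` Y| <= #|` addfs X Y| + 1)%N.
Proof.
move=> X0 Y0 Xinj.
have [x0 x0X x0min] := fset_argmin psi X0.
have [y1 y1Y y1max] := fset_argmin (fun y => - psi y) Y0.
pose U := addfs [fset x0]%fset Y; pose W := addfs X [fset y1]%fset.
have : (U `|` W `<=` addfs X Y)%fset.
  by rewrite fsubUset !addfsS ?fsub1set.
move/fsubset_leq_card; rewrite cardfsU /W card_addfsx /U addfsC card_addfsx -/W.
rewrite addfsC -/U.
have : (U `&` W `<=` [fset (x0 + y1)%R])%fset.
  apply/fsubsetP => z; rewrite in_fsetI.
  case/andP=> /addfsP[_ [y [/fset1P-> yY zE]]] /addfsP[x [_ [xX /fset1P-> zE']]].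
  rewrite in_fset1 zE'; apply/eqP; congr (_ + _); apply: Xinj => //.
  have := congr1 psi zE'; rewrite zE !raddfD /= => E.
  have := x0min _ xX; have := y1max _ yY; move: E; clear; lra.
move/fsubset_leq_card; rewrite cardfs1.
by lia.
Qed.

Lemma proj_top A : A != fset0 ->
  exists2 c, c \in proj A & {in A, forall a, phi a <= c}.
Proof.
move=> /(fset_argmin (fun y => - phi y))[a aA amax]; exists (phi a).
  exact: mem_proj.
by move=> b /amax; rewrite lerN2.
Qed.

Lemma fibre_inj A c : {in fibre A c &, injective psi}.
Proof.
move=> a b; rewrite !in_fibre => /andP[_ /eqP ac] /andP[_ /eqP bc] ab.
apply/eqP; rewrite -subr_eq0; apply/eqP/coord_inj; rewrite raddfB /=.
  by rewrite ac bc subrr.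
by rewrite ab subrr.
Qed.

(** On [A + B] the greatest value of [phi] is taken only at sums of points of the
    two top fibres, so none of these sums lies in [(A minus its top fibre) + B]. *)
Lemma card_addfs_top A B c e :
  c \in proj A -> {in A, forall a, phi a <= c} ->
  e \in proj B -> {in B, forall b, phi b <= e} ->
  (#|` addfs (A `\` fibre A c)%fset B| + #|` fibre A c| + #|` fibre B e|
     <= #|` addfs A B| + 1)%N.
Proof.
move=> cA Ac eB Be; pose U := addfs (A `\` fibre A c)%fset B.
pose W := addfs (fibre A c) (fibre B e).
have : (U `|` W `<=` addfs A B)%fset.
  by rewrite fsubUset !addfsS ?fibre_sub ?fsubsetDl.
move/fsubset_leq_card; rewrite cardfsU.
suff -> : (U `&` W)%fset = fset0.
  have := @leq_card_addfs_line (fibre A c) (fibre B e).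
  rewrite !fibre_neq0 cA eB => /(_ isT isT (@fibre_inj _ _)); rewrite -/U -/W cardfs0.
  by lia.
apply/fsetP => x; rewrite in_fsetI in_fset0; apply/negP.
case/andP=> /addfsP[a [b [aA bB xE]]] /addfsP[a' [b' [aA' bB' xE']]].
move: aA aA' bB'; rewrite in_fsetD !in_fibre.
case/andP=> + aA; rewrite aA /= => ac /andP[_ /eqP a'c] /andP[_ /eqP b'e].
have ac' : phi a < c by rewrite lt_neqAle ac Ac.
have := congr1 phi xE'; rewrite xE !raddfD /= a'c b'e.
by have := Be _ bB; move: ac'; clear; lra.
Qed.

(** The Grynkiewicz-Serra inequality
      [|A + B| >= (|A| / p + |B| / q - 1) (p + q - 1)]
    for sets covered by [p] and [q] parallel lines, cleared of denominators.
    Removing the top fibre of [A] or that of [B] loses at least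
    [|A_top| + |B_top| - 1] sums, and the average of the two inductive bounds with
    weights [p - 1] and [q - 1] is exactly the bound for [A] and [B]. *)
Lemma grynkiewicz_serra A B (p := #|` proj A|%:R) (q := #|` proj B|%:R) :
  (p + q - 1) * (q * #|` A|%:R + p * #|` B|%:R - p * q)
    <= p * q * #|` addfs A B|%:R :> F.
Proof.
rewrite /p /q {p q}.
have [n le_n] := ubnP (#|` proj A| + #|` proj B|)%N.
elim: n A B le_n => // n IH A B; rewrite ltnS => le_n.
have [->|A0] := eqVneq A fset0.
  have /eqP-> : proj fset0 == fset0 by rewrite proj_eq0.
  by rewrite !cardfs0 !(mul0r, mulr0, addr0, subr0).
have [->|B0] := eqVneq B fset0.
  have /eqP-> : proj fset0 == fset0 by rewrite proj_eq0.
  by rewrite !cardfs0 !(mul0r, mulr0, addr0, subr0).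
have [c cA Ac] := proj_top A0; have [e eB Be] := proj_top B0.
have sA := card_addfs_top cA Ac eB Be.
have sB := card_addfs_top eB Be cA Ac.
pose A' := (A `\` fibre A c)%fset; pose B' := (B `\` fibre B e)%fset.
have pA : #|` proj A| = #|` proj A'|.+1 by rewrite proj_fibreD (cardfsD1 c) cA.
have pB : #|` proj B| = #|` proj B'|.+1 by rewrite proj_fibreD (cardfsD1 e) eB.
have cA' : #|` A| = (#|` A'| + #|` fibre A c|)%N.
  by rewrite cardfsDS ?fibre_sub // subnK // fsubset_leq_card ?fibre_sub.
have cB' : #|` B| = (#|` B'| + #|` fibre B e|)%N.
  by rewrite cardfsDS ?fibre_sub // subnK // fsubset_leq_card ?fibre_sub.
have IHA := IH A' B; have IHB := IH A B'.
move: IHA IHB; rewrite pA pB => IHA IHB.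
have {}IHA := IHA ltac:(move: le_n; rewrite pA pB; lia).
have {}IHB := IHB ltac:(move: le_n; rewrite pA pB; lia).
move: IHA IHB sA sB; rewrite cA' cB' (addfsC B A) -/A' -/B' (addfsC B' A).
rewrite -!(ler_nat F) !natrD -!(natr1 #|` proj _|).
have [pq0|pq0] := eqVneq (#|` proj A'| + #|` proj B'|)%N 0%N.
  move/eqP: pq0; rewrite addn_eq0 !cardfs_eq0 !proj_eq0 => /andP[/eqP-> /eqP->].
  have /eqP-> : proj fset0 == fset0 by rewrite proj_eq0.
  have /eqP-> : addfs fset0 B == fset0.
    by apply/eqP/fsetP => x; rewrite in_fset0; apply/negP => /addfsP[? [? []]].
  by rewrite !cardfs0; lra.
have : 0 < #|` proj A'|%:R + #|` proj B'|%:R :> F by rewrite -natrD ltr0n lt0n.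
move: (ler0n F #|` proj A'|) (ler0n F #|` proj B'|).
move: (#|` proj A'|%:R) (#|` proj B'|%:R) => p q.
move: (#|` A'|%:R) (#|` fibre A c|%:R) (#|` B'|%:R) (#|` fibre B e|%:R) => u a v b.
move: (#|` addfs A' B|%:R) (#|` addfs A B'|%:R) (#|` addfs A B|%:R) => s1 s2 s.
move=> p0 q0 pq IHA IHB sA sB; rewrite -(ler_pM2l pq).
have p1 : 0 <= p + 1 by lra.
have q1 : 0 <= q + 1 by lra.
have {}IHA := ler_wpM2l p1 IHA; have {}IHB := ler_wpM2l q1 IHB.
have {}sA := ler_wpM2l (mulr_ge0 p0 (mulr_ge0 p1 q1)) sA.
have {}sB := ler_wpM2l (mulr_ge0 q0 (mulr_ge0 p1 q1)) sB.
lra.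
Qed.

End ParallelFibres.

(** * A direction with few lines *)

Section RichDirection.
Variable R : realType.

Lemma oppfs_diff (V : zmodType) (A : {fset V}) :
  oppfs (addfs A (oppfs A)) = addfs A (oppfs A).
Proof.
have oppK : oppfs (oppfs A) = A by apply/fsetP => x; rewrite !oppfsP opprK.
by rewrite oppfsD oppK addfsC.
Qed.

(** On each fibre of [phi] that meets [A], adding the progression with step [x]
    produces [2 ^ m] points, while [card_add_progression] bounds the total. *)
Lemma few_fibres_nat (V : lmodType R) (A : {fset V}) (k m : nat) :
  (#|` addfs (mulfs 3 A) (oppfs (mulfs 2 A))| <= k * #|` A|)%N ->
  (#|` addfs (mulfs 2 A) (oppfs A)| <= k * #|` A|)%N ->
  (0 < k)%N -> (k ^ m < #|` A|)%N ->
  exists2 x : V, x != 0 & forall phi : {additive V -> R}, phi x = 0 ->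
    (#|` proj phi A| * 2 ^ m <= (2 * m).+1 ^ k * (k * #|` A|))%N.
Proof.
move=> h32 h21 k0 km.
have A0 : A != fset0 by rewrite -cardfs_gt0; apply: leq_trans km.
have [a0 a0A] := fset0Pn _ A0.
pose D := addfs A (oppfs A).
have D0 : 0 \in D by rewrite -(subrr a0) mem_addfs // oppfsP opprK.
have AD : (#|` A| <= #|` D|)%N.
  apply: leq_card_addfsl; apply/fset0Pn; exists (- a0).
  by rewrite oppfsP opprK.
have [|Y [Yk YP]] := @ruzsa_covering _ (addfs D D) A k A0.
  apply: leq_trans h32; rewrite /mulfs /= !addfs0 oppfsD.
  suff -> : addfs (addfs D D) A =
      addfs (addfs A (addfs A A)) (addfs (oppfs A) (oppfs A)) by [].
  rewrite /D -(addfsA (addfs A (oppfs A))) (addfsC (addfs A (oppfs A))).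
  rewrite -(addfsA A (oppfs A) A) (addfsC (oppfs A) A) !addfsA.
  by rewrite (addfsAC _ (oppfs A) A).
have DY : {in D &, forall a b, exists y d, [/\ y \in Y, d \in D & a + b = y + d]}.
  by move=> a b aD bD; apply: YP; apply: mem_addfs.
have [|x x0 xD] := @dyadic_differences _ D Y m (fun d dD => DY d d dD dD).
  apply: leq_trans (leq_trans km AD); rewrite ltnS.
  by case: m {km} => // m; rewrite leq_exp2r.
exists x => // phi phix.
have AP := @card_add_progression _ A D Y x m D0 (oppfs_diff A) DY
  (fun i im => xD i (ltnW im)).
have AD2 : (#|` addfs A D| <= k * #|` A|)%N.
  by apply: leq_trans h21; rewrite /mulfs /= addfs0 /D addfsA.
apply: leq_trans (leq_trans AP _); last first.
  by rewrite leq_mul // leq_pexp2l.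
have cP : #|` [fset x *+ j | j in iota 0 (2 ^ m)]%fset| = (2 ^ m)%N.
  rewrite card_in_imfset /=; first by rewrite undup_id ?iota_uniq ?size_iota.
  move=> i j _ _ /eqP; rewrite -(scaler_nat i x) -(scaler_nat j x).
  by rewrite -subr_eq0 -scalerBl scaler_eq0 (negPf x0) orbF subr_eq0 eqr_nat => /eqP.
rewrite -[in X in (X <= _)%N]cP.
apply: (@card_proj_mul _ _ phi A _ 0) => _ /imfsetP[j /= _ ->].
by rewrite raddfMn /= phix mul0rn.
Qed.

(** The right side is [M * 2 ^ (m / 2)]. It comes from raising [1 + t <= expR t]
    to the power [k], at the value of [t] linear in [m] that makes the
    exponent [m * ln 2 / 2]. *)
Lemma poly_le_sqrt_exp (k : nat) : (0 < k)%N ->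
  exists2 M : R, 0 < M & forall m : nat,
    ((2 * m).+1 ^ k)%:R <= M * expR (ln 2 / 2 * m%:R).
Proof.
move=> k0; pose c : R := ln 2 / 2; have c0 : 0 < c by rewrite divr_gt0 ?ln_gt0 ?ltr1n.
have kR : 0 < k%:R :> R by rewrite ltr0n.
pose M : R := 1 + 2 * k%:R / c.
have M1 : 1 <= M by rewrite lerDl; apply/divr_ge0/ltW/c0; apply: mulr_ge0.
have M0 : 0 < M := lt_le_trans ltr01 M1.
exists (M ^+ k); first exact: exprn_gt0.
move=> m; rewrite natrX.
have -> : expR (ln 2 / 2 * m%:R) = expR (c * m%:R / k%:R) ^+ k.
  by rewrite -expRM_natl -/c; congr expR; field; rewrite gt_eqF.
rewrite -exprMn; apply: lerXn2r; rewrite ?nnegrE //.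
  by apply: mulr_ge0; [exact: ltW|exact: expR_ge0].
apply: le_trans (_ : M * (1 + c * m%:R / k%:R) <= _); last first.
  by apply: ler_wpM2l; [exact: ltW|exact: expR_ge1Dx].
rewrite -natr1 natrM mulrDr mulr1.
have -> : M * (c * m%:R / k%:R) = c * m%:R / k%:R + 2 * m%:R.
  by rewrite /M; field; rewrite !gt_eqF.
have : 0 <= c * m%:R / k%:R by apply: divr_ge0 => //; apply/mulr_ge0 => //; apply: ltW.
by move: M1; lra.
Qed.

(** Let [m] be the largest exponent with [k ^ m < |A|], for a bound [k] of the
    covering number. Then [2 ^ m] is about [|A| ^ (2 * delta)] with
    [delta = ln 2 / (2 * ln k)]. The polynomial factor of [few_fibres_nat] costs at
    most the square root of [2 ^ m], which leaves a saving of [|A| ^ delta]. *)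
Lemma few_parallel_fibres (C : R) : 1 < C ->
  exists K delta : R, [/\ 0 < K, 0 < delta, delta <= 2^-1 &
    forall (V : lmodType R) (A A' : {fset V}),
      (1 < #|` A|)%N -> #|` A'| = #|` A| ->
      #|` addfs A' A|%:R <= C * #|` A'|%:R ->
      exists2 x : V, x != 0 & forall phi : {additive V -> R}, phi x = 0 ->
        #|` proj phi A|%:R <= K * #|` A|%:R `^ (1 - delta)].
Proof.
(* [C ^ 5] bounds the ratio for [3 A - 2 A]; with [2 <= k] one gets [delta <= 1 / 2]. *)
move=> C1; pose k := (Num.truncn (C ^+ 5)).+2.
have kC5 : C ^+ 5 <= k%:R.
  have /ltW/le_trans := @truncnS_gt _ (C ^+ 5); apply.
  by rewrite ler_nat.
have k1 : (1 < k)%N by [].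
have kR : 1 < k%:R :> R by rewrite ltr1n.
have lnk : 0 < ln k%:R :> R by rewrite ln_gt0.
have [M M0 HM] := @poly_le_sqrt_exp k isT.
pose delta : R := ln 2 / ln k%:R / 2.
have ln2 : 0 < ln 2 :> R by rewrite ln_gt0 // ltr1n.
exists (2 * M * k%:R), delta; split.
- by apply: mulr_gt0; [apply: mulr_gt0|]; lra.
- by rewrite !divr_gt0.
- rewrite /delta ler_pdivrMr // mulVf ?pnatr_eq0 // ler_pdivrMr // mul1r.
  by rewrite ler_ln ?posrE ?ler_nat ?ltr0n.
move=> V A A' A1 cAA' hA.
have A'0 : A' != fset0 by rewrite -cardfs_gt0 cAA' ltnW.
have P n m : (n + m <= 5)%N ->
    (#|` addfs (mulfs n A) (oppfs (mulfs m A))| <= k * #|` A|)%N.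
  move=> nm; rewrite -(ler_nat R) natrM.
  apply: le_trans (plunnecke_ruzsa n m A'0 hA) _; rewrite cAA' ler_wpM2r //.
  by apply: le_trans kC5; rewrite ler_eXn2l.
pose m := trunc_log k (#|` A|).-1.
have /andP[mA Am] : (k ^ m <= (#|` A|).-1 < k ^ m.+1)%N.
  by apply: trunc_log_bounds => //; rewrite -ltnS prednK // ltnW.
have [||||x x0 xP] := @few_fibres_nat V A k m.
- exact: P.
- by have := P 2 1 isT; rewrite mulfs1.
- by [].
- by move: mA A1; case: #|` A|.
exists x => // phi /xP.
rewrite -(ler_nat R) 3!natrM.
set n := #|` A|; set r := #|` _|; pose E : R := expR (ln 2 / 2 * m%:R).
have E0 : 0 < E := expR_gt0 _.
have E2 : (2 ^ m)%:R = E ^+ 2.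
  rewrite -expRM_natl natrX -[in LHS](@lnK R 2) ?posrE // -expRM_natl.
  by congr expR; field.
have nR : 0 < n%:R :> R by rewrite ltr0n ltnW.
have nE : n%:R `^ delta <= 2 * E.
  rewrite -(@ler_pXn2r _ 2) ?nnegrE ?powR_ge0 ?mulr_ge0 ?(ltW E0) //.
  rewrite -powR_mulrn ?powR_ge0 // -powRrM.
  have -> : delta * 2%:R = ln 2 / ln k%:R by rewrite /delta; field; rewrite gt_eqF.
  apply: (le_trans (y := (k ^ m.+1)%:R `^ (ln 2 / ln k%:R))).
    rewrite ge0_ler_powR ?nnegrE //; first by rewrite divr_ge0 ?ltW.
    rewrite ler_nat; move: Am; rewrite -/n; lia.
  have k2 : k%:R `^ (ln 2 / ln k%:R) = 2 :> R.
    by rewrite /powR pnatr_eq0 /= divfK ?gt_eqF // lnK ?posrE.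
  rewrite natrX -powR_mulrn // -powRrM mulrC powRrM k2 powR_mulrn // exprMn -E2.
  rewrite exprS natrX; have : 0 <= 2 ^+ m :> R by apply: exprn_ge0.
  lra.
rewrite E2 => rE.
have {}rE : r%:R * E <= M * (k%:R * n%:R).
  rewrite -(ler_pM2r E0) -mulrA -expr2; apply: le_trans rE _.
  have := HM m; rewrite -/E => /(ler_wpM2r (_ : 0 <= k%:R * n%:R)).
  by rewrite mulr_ge0 // => /(_ isT)/le_trans; apply; rewrite mulrAC.
have nd : 0 < n%:R `^ delta by rewrite powR_gt0.
rewrite -(ler_pM2r nd) -[leRHS]mulrA -powRD; last by rewrite (gt_eqF nR) implybT.
rewrite subrK powRr1 ?(ltW nR) //.
apply: (le_trans (y := r%:R * (2 * E))); first by rewrite ler_wpM2l.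
move: rE; lra.
Qed.

End RichDirection.

(** * Lines in the plane and a map without real eigenvalues *)

Section Plane.
Variable R : realType.
Local Notation V := 'rV[R]_2.
Implicit Types (v x : V) (L : 'M[R]_2) (A S X : {fset V}).

(** The lines along [v] are the level sets of [cross v], and [dot v] is a
    coordinate on each of them. *)
Definition cross v x : R := x 0 0 * v 0 1 - x 0 1 * v 0 0.
Definition dot v x : R := x 0 0 * v 0 0 + x 0 1 * v 0 1.

Fact cross_is_zmod_morphism v : zmod_morphism (cross v).
Proof. by move=> x y; rewrite /cross !mxE; ring. Qed.
HB.instance Definition _ v :=
  GRing.isZmodMorphism.Build V R (cross v) (cross_is_zmod_morphism v).

Fact dot_is_zmod_morphism v : zmod_morphism (dot v).
Proof. by move=> x y; rewrite /dot !mxE; ring. Qed.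
HB.instance Definition _ v :=
  GRing.isZmodMorphism.Build V R (dot v) (dot_is_zmod_morphism v).

Lemma row2P (x y : V) : x 0 0 = y 0 0 -> x 0 1 = y 0 1 -> x = y.
Proof.
move=> E0 E1; apply/rowP => -[[|[|//]] lt].
  by rewrite (_ : Ordinal lt = 0) //; apply: val_inj.
by rewrite (_ : Ordinal lt = 1) //; apply: val_inj.
Qed.

Lemma dot_self_neq0 v : v != 0 -> dot v v != 0.
Proof.
apply: contraNneq; rewrite /dot => E; apply/eqP/row2P; rewrite !mxE; nra.
Qed.

Lemma cross_self v : cross v v = 0.
Proof. by rewrite /cross; ring. Qed.

Lemma cross_dot_inj v x : v != 0 -> cross v x = 0 -> dot v x = 0 -> x = 0.
Proof.
move=> /dot_self_neq0 vv; rewrite /cross /dot in vv *.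
move=> Ec Ed; apply/row2P; rewrite !mxE; apply: (mulfI vv); rewrite mulr0.
  rewrite -[LHS](_ : v 0 1 * (x 0 0 * v 0 1 - x 0 1 * v 0 0) +
    v 0 0 * (x 0 0 * v 0 0 + x 0 1 * v 0 1) = _); last by ring.
  by rewrite Ec Ed !mulr0 addr0.
rewrite -[LHS](_ : - v 0 0 * (x 0 0 * v 0 1 - x 0 1 * v 0 0) +
  v 0 1 * (x 0 0 * v 0 0 + x 0 1 * v 0 1) = _); last by ring.
by rewrite Ec Ed !mulr0 addr0.
Qed.

Lemma crossZ v t x : cross v (t *: x) = t * cross v x.
Proof. by rewrite /cross !mxE; ring. Qed.

Lemma dotZ v t x : dot v (t *: x) = t * dot v x.
Proof. by rewrite /dot !mxE; ring. Qed.

Lemma cross_eq0 v x : v != 0 -> cross v x = 0 <-> exists t, x = t *: v.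
Proof.
move=> v0; split=> [Ec|[t ->]]; last by rewrite crossZ cross_self mulr0.
exists (dot v x / dot v v); apply/eqP; rewrite -subr_eq0; apply/eqP.
apply: (cross_dot_inj v0); rewrite raddfB /=.
  by rewrite Ec crossZ cross_self mulr0 subr0.
by rewrite dotZ divfK ?subrr // dot_self_neq0.
Qed.

Lemma levels_parallel (f : {additive V -> R}) (d : V) n (c : 'I_n -> R) :
  d != 0 -> (forall x, f x = 0 <-> exists t, x = t *: d) -> injective c ->
  (forall i, exists p, f p = c i) ->
  parallel_lines (fun i => [set x | f x = c i]).
Proof.
move=> d0 fd cI cP.
have levelE p e : f p = e -> [set x | f x = e] = line p d.
  move=> pe; apply/seteqP; split=> x /=.
    move=> xe; have /fd[t xp] : f (x - p) = 0 by rewrite raddfB /= xe pe subrr.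
    by exists t => //; rewrite -xp addrC subrK.
  move=> [t _ <-]; rewrite raddfD /= pe.
  by have /fd-> : exists t', t *: d = t' *: d; [exists t|rewrite addr0].
split=> [i j E|i j].
  have [p pi] := cP i; apply: cI; rewrite -pi.
  by have : [set x | f x = c i] p by []; rewrite E.
have [p pi] := cP i; have [q qj] := cP j.
by exists d, p, q; rewrite (levelE _ _ pi) (levelE _ _ qj).
Qed.

Lemma in_linimage L A x : x \in A -> x *m L \in linimage L A.
Proof. by move=> xA; apply/imfsetP; exists x. Qed.

Lemma card_linimage L A : L \in unitmx -> #|` linimage L A| = #|` A|.
Proof. by move=> Lu; apply: card_in_imfset => x y _ _; apply: (can_inj (mulmxK Lu)). Qed.

Section NoRealEigenvalue.
Variables (L : 'M[R]_2) (v : V).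
Hypotheses (noeig : forall a : R, ~~ eigenvalue L a) (v0 : v != 0).

Lemma cross_image_neq0 : cross v (v *m L) != 0.
Proof.
apply/eqP => /(cross_eq0 _ v0)[t E]; have /negP := noeig t; apply.
by apply/eigenvalueP; exists v.
Qed.

(** Since [v] and [v *m L] are independent, the sums of a set on a line along [v]
    with its image fill a parallelogram. *)
Lemma card_fibre_square A c :
  (#|` fibre (cross v) A c| ^ 2 <= #|` sumset A (linimage L A)|)%N.
Proof.
rewrite -mulnn -card_fsetX; apply: (@leq_card_inj _ _ (fun u => u.1 + u.2 *m L)).
  move=> [x y] [x' y']; rewrite !in_fsetM !in_fibre /=.
  move=> /andP[/andP[_ /eqP xc] /andP[_ /eqP yc]].
  move=> /andP[/andP[_ /eqP xc'] /andP[_ /eqP yc']] E.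
  have /(cross_eq0 _ v0)[t yE] : cross v (y - y') = 0.
    by rewrite raddfB /= yc yc' subrr.
  have : cross v ((y - y') *m L) = 0.
    have -> : (y - y') *m L = x' - x.
      by apply/eqP; rewrite mulmxBl subr_eq addrAC -E addrAC subrr add0r.
    by rewrite raddfB /= xc xc' subrr.
  rewrite yE -scalemxAl crossZ => /eqP.
  rewrite mulf_eq0 (negPf cross_image_neq0) orbF => /eqP t0.
  have yy' : y = y' by apply/eqP; rewrite -subr_eq0 yE t0 scale0r.
  by move: E; rewrite yy' => /addIr->.
move=> [x y]; rewrite in_fsetM !in_fibre /= => /andP[/andP[xA _] /andP[yA _]].
by apply/mem_addfs/in_linimage.
Qed.

(** A common direction [d] would be a multiple of [v], and so would [d *m L]. *)
Lemma levels_not_parallel c e :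
  ~ parallel [set x | cross v x = c] [set x | cross v (x *m L) = e].
Proof.
move=> [d [p [q [d0 Ep Eq]]]].
have dv : cross v d = 0.
  have pc : cross v p = c.
    by have : line p d p; [exists 0; rewrite // scale0r addr0|rewrite -Ep].
  have : line p d (p + d) by exists 1; rewrite // scale1r.
  by rewrite -Ep /= raddfD /= pc -[RHS]addr0 => /addrI.
have dLv : cross v (d *m L) = 0.
  have qe : cross v (q *m L) = e.
    by have : line q d q; [exists 0; rewrite // scale0r addr0|rewrite -Eq].
  have : line q d (q + d) by exists 1; rewrite // scale1r.
  by rewrite -Eq /= mulmxDl raddfD /= qe -[RHS]addr0 => /addrI.
have /(cross_eq0 _ v0)[t dE] := dv; move: dLv.
rewrite dE -scalemxAl crossZ => /eqP; rewrite mulf_eq0 (negPf cross_image_neq0) orbF.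
by move=> /eqP t0; move: d0; rewrite dE t0 scale0r eqxx.
Qed.

End NoRealEigenvalue.

Lemma ncap_level A v c : ncap A [set x | cross v x = c] = #|` fibre (cross v) A c|%:R.
Proof.
congr (_%:R); congr (#|` _|); apply/fsetP => x; rewrite !inE /=.
congr (_ && _); apply/idP/eqP => [|E]; first by rewrite in_setE.
by rewrite in_setE.
Qed.

End Plane.

(** * The rich lines *)

Section RichFibres.
Variables (F : realFieldType) (V : zmodType) (phi : {additive V -> F}).
Variables (A : {fset V}) (a : nat).

(** The condition [sqrt a <= |fibre|] is squared to stay in the natural numbers. *)
Definition rich : {fset V} :=
  [fset x in A | (a <= #|` fibre phi A (phi x)| ^ 2)%N]%fset.

Lemma in_rich x :
  (x \in rich) = (x \in A) && (a <= #|` fibre phi A (phi x)| ^ 2)%N.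
Proof. by rewrite !inE. Qed.

Lemma rich_sub : (rich `<=` A)%fset.
Proof. by apply/fsubsetP => x; rewrite in_rich => /andP[]. Qed.

Lemma in_proj_rich c :
  (c \in proj phi rich) = (c \in proj phi A) && (a <= #|` fibre phi A c| ^ 2)%N.
Proof.
apply/imfsetP/andP => [[x /=]|[/imfsetP[x /= xA ->] ax]].
  by rewrite in_rich => /andP[xA ax] ->; rewrite mem_proj.
by exists x; rewrite // in_rich xA.
Qed.

Lemma fibre_rich c : c \in proj phi rich -> fibre phi rich c = fibre phi A c.
Proof.
rewrite in_proj_rich => /andP[_ ac]; apply/fsetP => x.
rewrite !in_fibre in_rich; case: eqP => [->|]; last by rewrite !andbF.
by rewrite ac andbT.
Qed.

Lemma card_rich_ge (s : F) : 0 <= s -> s ^+ 2 <= a%:R ->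
  #|` proj phi rich|%:R * s <= #|` rich|%:R.
Proof.
move=> s0 sa; rewrite (card_fibres phi rich) natr_sum mulrC.
rewrite -[X in s * X%:R]sum1_size natr_sum mulr_sumr !big_seq.
apply: ler_sum => c cS; rewrite mulr1 fibre_rich //.
move: cS; rewrite in_proj_rich => /andP[_ ac].
by rewrite -(@ler_pXn2r _ 2) ?nnegrE // (le_trans sa) // -natrX ler_nat.
Qed.

Lemma card_poor_le (s : F) : 0 <= s -> a%:R <= s ^+ 2 ->
  #|` (A `\` rich)%fset|%:R <= #|` proj phi A|%:R * s.
Proof.
move=> s0 sa; set B := (A `\` rich)%fset.
have BA : (proj phi B `<=` proj phi A)%fset.
  by apply/fsubsetP => _ /imfsetP[x /= xB ->]; apply/mem_proj/(fsubsetP _ _ xB)/fsubsetDl.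
apply: (le_trans (y := #|` proj phi B|%:R * s)); last first.
  by rewrite ler_wpM2r // ler_nat fsubset_leq_card.
rewrite (card_fibres phi B) natr_sum mulrC.
rewrite -[X in _ <= s * X%:R]sum1_size natr_sum mulr_sumr !big_seq.
apply: ler_sum => _ /imfsetP[x /= xB ->]; rewrite mulr1.
apply: (le_trans (y := #|` fibre phi A (phi x)|%:R)).
  rewrite ler_nat; apply/fsubset_leq_card/fsubsetP => y.
  by rewrite !in_fibre in_fsetD => /andP[/andP[_ ->] ->].
move: xB; rewrite in_fsetD in_rich => /andP[+ xA]; rewrite xA /= -ltnNge => lt_a.
rewrite -(@ler_pXn2r _ 2) ?nnegrE // (le_trans _ sa) // -natrX ler_nat ltnW //.
Qed.

End RichFibres.

Lemma card_le_proj_mul (F : realFieldType) (V : zmodType)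
    (phi : {additive V -> F}) (A : {fset V}) (a : nat) :
  (forall c, #|` fibre phi A c| <= a)%N -> (#|` A| <= #|` proj phi A| * a)%N.
Proof.
move=> Aa; rewrite (card_fibres phi A) -[X in (_ <= X * _)%N]sum1_size big_distrl /=.
by apply: leq_sum => c _; rewrite mul1n.
Qed.

(** [r] fibres of at most [a] points cover [n] points, so [r <= K n ^ (1 - delta)]
    forces [a >= n ^ delta / K]; and the [b] points on fibres below [sqrt a] are
    few because [r a <= C ^ 2 n]. *)
Lemma threshold_bounds (R : realType) (C K delta n r a b : R) :
  1 <= K -> 1 <= n -> 0 < a -> 0 <= r -> 0 <= b ->
  n <= r * a -> r <= K * n `^ (1 - delta) -> r * a <= C ^+ 2 * n ->
  b <= r * a `^ 2^-1 ->
  n `^ (delta / 2) <= K * a `^ 2^-1 /\ b <= K * C ^+ 2 * n `^ (1 - delta / 2).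
Proof.
move=> K1 n1 a0 r0 b0 nra rK raC br; set s := a `^ 2^-1 in br *.
have n0 : 0 < n by lra.
have s0 : 0 < s by rewrite powR_gt0.
have aE : a = s * s.
  have half : 2^-1 + 2^-1 = 1 :> R by field.
  by rewrite -powRD ?(gt_eqF a0) ?implybT // half powRr1 ?ltW.
set u := n `^ (delta / 2); have u0 : 0 < u by rewrite powR_gt0.
have uu : n `^ delta = u * u by rewrite -powRD ?(gt_eqF n0) ?implybT // -splitr.
have nE : n `^ (1 - delta) * n `^ delta = n.
  by rewrite -powRD ?(gt_eqF n0) ?implybT // subrK powRr1 ?ltW.
have nE2 : n `^ (1 - delta / 2) * u = n.
  by rewrite -powRD ?(gt_eqF n0) ?implybT // subrK powRr1 ?ltW.
have nd : 0 < n `^ (1 - delta) by rewrite powR_gt0.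
have us : u <= K * s.
  have uK : u * u <= K * (s * s).
    rewrite -uu -aE -(ler_pM2l nd) nE; apply: le_trans nra _.
    by rewrite mulrA (mulrC _ K) ler_pM2r.
  have K0 : 0 <= K by lra.
  rewrite -(@ler_pXn2r _ 2) ?nnegrE ?(ltW u0) ?mulr_ge0 ?(ltW s0) //.
  rewrite !expr2 mulrACA; apply: le_trans uK _.
  by rewrite ler_pM2r ?mulr_gt0 // ler_peMl.
split=> //; rewrite -(ler_pM2r u0) -[leRHS]mulrA nE2.
apply: (le_trans (y := b * (K * s))); first by rewrite ler_wpM2l.
have : b * s <= r * s * s by rewrite ler_pM2r.
rewrite -[leRHS]mulrA -aE => /le_trans/(_ raC) bs.
have K0 : 0 <= K by lra.
by rewrite mulrCA -[leRHS]mulrA ler_wpM2l.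
Qed.

(** * Numerical bounds *)

(** When [p] and [q] differ by a large factor the Grynkiewicz-Serra bound exceeds
    [2 * C * T]. *)
Lemma line_numbers_comparable (F : realFieldType) (C p q T M : F) :
  1 < C -> 1 <= p -> 1 <= q -> 2 * p <= T -> M <= 2 * C * T ->
  (p + q - 1) * (q * T + p * T - p * q) <= p * q * M ->
  q <= 8 * C * p /\ p <= 8 * C * q.
Proof.
move=> C1 p1 q1 pT MT gs.
have T0 : 0 < T by lra.
have p0 : 0 < p by lra.
have q0 : 0 < q by lra.
have C0 : 0 < C by lra.
have {}gs : (p + q - 1) * (q * T + p * T - p * q) <= p * q * (2 * C * T).
  by apply: le_trans gs _; rewrite ler_wpM2l // ltW // mulr_gt0.
have pq : p * q <= q * T / 2.
  have := ler_wpM2l (ltW q0) pT; lra.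
have qT : 0 < q * T by apply: mulr_gt0.
have pT0 : 0 < p * T by apply: mulr_gt0.
split.
  have h : q * (q * T / 2) <= (p + q - 1) * (q * T + p * T - p * q).
    by apply: ler_pM; lra.
  have {}h := le_trans h gs.
  have : (q * T) * q <= (q * T) * (4 * C * p) by move: h; lra.
  rewrite ler_pM2l // => /le_trans; apply.
  by rewrite ler_pM2r // ler_pM2r // ler_nat.
have h : p * (p * T) <= (p + q - 1) * (q * T + p * T - p * q).
  by apply: ler_pM; lra.
have {}h := le_trans h gs.
have : (p * T) * p <= (p * T) * (2 * C * q) by move: h; lra.
rewrite ler_pM2l // => /le_trans; apply.
by rewrite ler_pM2r // ler_pM2r // ler_nat.
Qed.

(** The error terms of the Grynkiewicz-Serra bound: the [b] points outside the chosen
    lines, [T / p + T / q] and [p + q]. *)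
Lemma main_term_bound (F : realFieldType) (C K p q T b w M : F) :
  1 < C -> 1 <= p -> 1 <= q -> 0 <= b -> 0 <= w -> 0 <= T ->
  q <= 8 * C * p -> p <= 8 * C * q ->
  (p + q - 1) * (q * T + p * T - p * q) <= p * q * M ->
  b <= K * C ^+ 2 * w -> p <= K * w -> T <= 4 * C * w * p ->
  (T + b) * (q / p + p / q + 2) -
    (K * C ^+ 2 * (16 * C + 2) + 4 * C * (1 + 8 * C) + K * (1 + 8 * C)) * w <= M.
Proof.
move=> C1 p1 q1 b0 w0 T0 qp pq gs bw pw Tw.
have p0 : 0 < p by lra.
have q0 : 0 < q by lra.
have C0 : 0 < C by lra.
have ratio : 0 <= q / p + p / q + 2 <= 16 * C + 2.
  have : q / p <= 8 * C by rewrite ler_pdivrMr.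
  have : p / q <= 8 * C by rewrite ler_pdivrMr.
  have : 0 <= q / p by rewrite divr_ge0 ?ltW.
  have : 0 <= p / q by rewrite divr_ge0 ?ltW.
  by move=> ? ? ? ?; apply/andP; split; lra.
have hb : b * (q / p + p / q + 2) <= K * C ^+ 2 * w * (16 * C + 2).
  by case/andP: ratio => r0 r1; apply: ler_pM.
have hT : T / p + T / q <= 4 * C * w * (1 + 8 * C).
  have h1 : T / p <= 4 * C * w by rewrite ler_pdivrMr.
  have h2 : T / q <= T / p * (8 * C).
    rewrite ler_pdivrMr // (_ : _ * q = T * (8 * C * q / p)); last first.
      by field; rewrite gt_eqF.
    by rewrite ler_peMr // ler_pdivlMr ?mul1r.
  have : T / p * (8 * C) <= 4 * C * w * (8 * C) by rewrite ler_pM2r //; lra.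
  by move: h1 h2; lra.
have hpq : p + q <= K * w * (1 + 8 * C).
  have : p * (8 * C) <= K * w * (8 * C) by rewrite ler_pM2r //; lra.
  by move: pw qp; lra.
have hM : T * (q / p + p / q + 2) - (T / p + T / q) - (p + q) + 1 <= M.
  have pq0 : 0 < p * q by apply: mulr_gt0.
  rewrite -(ler_pM2l pq0); apply: le_trans gs.
  rewrite le_eqVlt; apply/orP; left; apply/eqP; field.
  by rewrite !gt_eqF.
by rewrite mulrDl; move: hb hT hpq hM; lra.
Qed.

Lemma large_powR (R : realType) (sigma M : R) : 0 < sigma -> 0 <= M ->
  exists N : nat, forall n : nat, (N <= n)%N -> M <= n%:R `^ sigma.
Proof.
move=> s0 M0; exists (Num.truncn (M `^ sigma^-1)).+1 => n nN.
have -> : M = (M `^ sigma^-1) `^ sigma.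
  by rewrite -powRrM mulVf ?powRr1 // lt0r_neq0.
apply: ge0_ler_powR; rewrite ?nnegrE ?powR_ge0 ?(ltW s0) //.
by apply: ltW; apply: (lt_le_trans (truncnS_gt _)); rewrite ler_nat.
Qed.

(** The points outside the rich fibres are at most half of the set once
    [n ^ (delta / 2)] exceeds the constants. *)
Lemma rich_part_large (R : realType) (C K delta n r a b T : R) :
  1 < C -> 1 <= K -> 1 <= n -> 0 < a -> 0 <= r -> 0 <= b ->
  2 * (K * C ^+ 2) <= n `^ (delta / 2) ->
  n <= r * a -> r <= K * n `^ (1 - delta) -> r * a <= C ^+ 2 * n ->
  b <= r * a `^ 2^-1 -> n = T + b ->
  [/\ n `^ (delta / 2) <= K * a `^ 2^-1, b <= K * C ^+ 2 * n `^ (1 - delta / 2),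
      2 <= a `^ 2^-1 & n / 2 <= T].
Proof.
move=> C1 K1 n1 a0 r0 b0 uL nra rK raC Br nE.
have [us Bw] := threshold_bounds K1 n1 a0 r0 b0 nra rK raC Br.
have n0 : 0 < n by lra.
have uw : n `^ (1 - delta / 2) * n `^ (delta / 2) = n.
  by rewrite -powRD ?(gt_eqF n0) ?implybT // subrK powRr1 // ltW.
have w0 : 0 < n `^ (1 - delta / 2) by rewrite powR_gt0.
have C21 : 1 <= C ^+ 2 by rewrite exprn_ege1 // ltW.
move: us Bw uL uw w0 {Br}; set s := a `^ _; set u := _ `^ _; set w := _ `^ _.
move=> us Bw uL uw w0; split=> //.
  have Kp : 0 < K by lra.
  have : K * (2 * C ^+ 2) <= K * s by lra.
  by rewrite ler_pM2l //; lra.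
have : w * (2 * (K * C ^+ 2)) <= n by rewrite -[leRHS]uw ler_pM2l.
by lra.
Qed.

(** As [a < sqrt (C * n)], the [T >= n / 2] points need at least
    [sqrt n / (4 * sqrt C)] lines, so [T / p] is of the order of [sqrt n] and, since
    [sigma <= 1 / 2], belongs to the error term. *)
Lemma structure_bounds (R : realType) (C K sigma n a b T p q M : R) :
  1 < C -> sigma <= 2^-1 -> 1 <= n -> 0 <= a -> 0 <= b -> 1 <= p -> 1 <= q ->
  n = T + b -> n / 2 <= T -> 2 * p <= T -> T <= p * a ->
  a ^+ 2 < C * n -> M < C * n ->
  b <= K * C ^+ 2 * n `^ (1 - sigma) -> p <= K * n `^ (1 - sigma) ->
  (p + q - 1) * (q * T + p * T - p * q) <= p * q * M ->
  [/\ a < (2 * C) `^ 2^-1 * n `^ 2^-1,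
      (4 * C `^ 2^-1)^-1 * n `^ 2^-1 <= p, (8 * C)^-1 * p <= q, q <= 8 * C * p &
      n * (q / p + p / q + 2) -
        (K * C ^+ 2 * (16 * C + 2) + 4 * C * (1 + 8 * C) + K * (1 + 8 * C)) *
          n `^ (1 - sigma) <= M].
Proof.
move=> C1 s2 n1 a0 b0 p1 q1 nE Thalf psT Tpa aa MC Bw pw gs.
have C0 : 0 < C by lra.
have n0 : 0 < n by lra.
have T0 : 0 <= T by lra.
have [qp pq] : q <= 8 * C * p /\ p <= 8 * C * q.
  apply: (line_numbers_comparable C1 p1 q1 psT _ gs).
  by have := ler_wpM2l (ltW C0) Thalf; lra.
have hh : n `^ 2^-1 ^+ 2 = n.
  by rewrite -powR_mulrn ?powR_ge0 // -powRrM mulVf // powRr1 // ltW.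
have gg : C `^ 2^-1 ^+ 2 = C.
  by rewrite -powR_mulrn ?powR_ge0 // -powRrM mulVf // powRr1 // ltW.
have hw : n `^ 2^-1 <= n `^ (1 - sigma) by apply: ler_powR => //; lra.
have g1 : 1 <= C `^ 2^-1 by rewrite -[leLHS](powRr0 C) ler_powR ?ltW ?invr_ge0.
have gC : C `^ 2^-1 <= (2 * C) `^ 2^-1.
  by apply: ge0_ler_powR; rewrite ?nnegrE ?invr_ge0 //; lra.
have h0 : 0 < n `^ 2^-1 by rewrite powR_gt0.
have w0 : 0 <= n `^ (1 - sigma) by apply: powR_ge0.
move: Bw pw hh gg hw g1 gC h0 w0.
set h := n `^ 2^-1; set w := n `^ (1 - sigma); set g := C `^ 2^-1.
move: h w g (_ `^ _) => h w g g2 Bw pw hh gg hw g1 gC h0 w0.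
have g0 : 0 < g by lra.
have agh : a < g * h.
  rewrite -(@ltr_pXn2r _ 2) ?nnegrE // ?exprMn ?gg ?hh //.
  by rewrite mulr_ge0 // ltW.
have TA : T <= h * h by rewrite -expr2 hh; lra.
have hp : h <= 4 * g * p.
  have : p * a <= p * (g * h) by rewrite ler_pM2l ?(ltW agh) //; lra.
  move/(le_trans Tpa)/(le_trans Thalf); rewrite -hh expr2 => H.
  have : h * h <= h * (2 * (g * p)) by lra.
  rewrite ler_pM2l //; have : 0 < g * p by apply: mulr_gt0 => //; lra.
  by lra.
split.
- by apply: lt_le_trans agh _; rewrite ler_pM2r.
- by rewrite ler_pdivrMl // mulr_gt0.
- by rewrite ler_pdivrMl // mulr_gt0.
- by [].
rewrite nE; apply: main_term_bound => //.
have gC' : g <= C by rewrite -gg expr2 ler_peMl // ltW.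
have gp : 4 * g * p <= 4 * C * p by rewrite ler_pM2r; lra.
have := ler_pM (ltW h0) (ltW h0) hw (le_trans hp gp).
by move: TA; lra.
Qed.

(** * The structure theorem *)

Theorem theorem5p2 (R : realType) (C : R) (hC : 1 < C) :
  exists C1 sigma : R, [/\ 0 < C1, 0 < sigma, sigma <= 2^-1 &
  exists (N : nat) (K : R), 0 < K /\
  forall (L : 'M[R]_2) (A : {fset 'rV[R]_2}),
    L \in unitmx ->
    (forall a : R, ~~ eigenvalue L a) ->
    let cA : R := #|` A|%:R in
    let cALA : R := #|` sumset A (linimage L A)|%:R in
    cALA < C * cA ->
    (N <= #|` A|)%N ->
    exists S B : {fset 'rV[R]_2},
      (A = (S `|` B)%fset /\ [disjoint S & B]%fset) /\
      exists (n1 n2 : nat)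
             (l : 'I_n1.+1 -> set 'rV[R]_2) (m : 'I_n2.+1 -> set 'rV[R]_2),
      let r1 : R := n1.+1%:R in
      let r2 : R := n2.+1%:R in
      [/\ (* (1) *)
          [/\ parallel_lines l,
              [set` S] = (\bigcup_i l i) `&` [set` A] &
              #|` B|%:R <= C1 * (2 * C) ^+ 6 * cA `^ (1 - sigma)],
          (* (2) *)
          [/\ ncap A (l ord0) < (2 * C) `^ 2^-1 * cA `^ 2^-1,
              (forall i j : 'I_n1.+1, (i <= j)%N ->
                 ncap A (l j) <= ncap A (l i)),
              ncap A (l ord0) `^ 2^-1 <= ncap A (l ord_max) &
              C1^-1 * cA `^ sigma <= ncap A (l ord0) `^ 2^-1],
          (* (3) *)
          (4 * C `^ 2^-1)^-1 * cA `^ 2^-1 <= r1 /\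
            r1 <= C1 * cA `^ (1 - sigma),
          (* (4) *)
          [/\ parallel_lines m,
              ~ parallel (l ord0) (m ord0),
              [set` S] = (\bigcup_i m i) `&` [set` S],
              (8 * C)^-1 * r1 <= r2 &
              r2 <= 8 * C * r1] &
          (* (5) *)
          cA * (r2 / r1 + r1 / r2 + 2) - K * cA `^ (1 - sigma) <= cALA]].
Proof.
have [K0 [delta [K00 d0 d2 rich_dir]]] := few_parallel_fibres hC.
pose K := K0 + 1; pose sigma := delta / 2.
have K1 : 1 <= K by rewrite /K; lra.
have s0 : 0 < sigma by rewrite /sigma; lra.
have C20 : 0 < C ^+ 2 by rewrite exprn_gt0 //; lra.
have C21 : 1 <= C ^+ 2 by rewrite exprn_ege1 // ltW.
have [N0 N0P] : exists N : nat, forall n : nat, (N <= n)%N ->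
    2 * (K * C ^+ 2) <= n%:R `^ sigma.
  by apply: large_powR => //; rewrite !mulr_ge0 ?(ltW C20) //; lra.
have sd : sigma <= delta by rewrite /sigma; lra.
have sigma2 : sigma <= 2^-1 by rewrite /sigma; lra.
exists K, sigma; split=> //; first exact: lt_le_trans K1.
exists (maxn N0 2).
exists (K * C ^+ 2 * (16 * C + 2) + 4 * C * (1 + 8 * C) + K * (1 + 8 * C)); split.
  rewrite !addr_gt0 // !mulr_gt0 //; lra.
move=> L A Lu noeig cA cALA hA; rewrite geq_max => /andP[nN n2].
pose A' := linimage L A.
have cA' : #|` A'| = #|` A| by apply: card_linimage.
have hA' : #|` addfs A' A|%:R <= C * #|` A'|%:R.
  by rewrite addfsC cA'; apply: ltW.
have [v v0 few] := rich_dir _ _ _ n2 cA' hA'.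
pose phi : {additive 'rV[R]_2 -> R} := cross v.
have {few} few : #|` proj phi A|%:R <= K0 * cA `^ (1 - delta) := few _ (cross_self v).
have A0 : A != fset0 by rewrite -cardfs_gt0 ltnW.
have pA0 : proj phi A != fset0 by rewrite proj_eq0.
have [c1 c1A c1max] :=
  fset_argmin (fun c => - (#|` fibre phi A c|%:R : R)) pA0.
pose a := #|` fibre phi A c1|.
have a0 : (0 < a)%N by rewrite cardfs_gt0 fibre_neq0.
have amax c : (#|` fibre phi A c| <= a)%N.
  have [cpA|] := boolP (c \in proj phi A).
    by have := c1max _ cpA; rewrite lerN2 ler_nat.
  by rewrite -fibre_neq0 negbK => /eqP->; rewrite cardfs0.
pose S := rich phi A a; pose B := (A `\` S)%fset.
have SA : (S `<=` A)%fset := rich_sub _ _ _.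
pose r : R := #|` proj phi A|%:R.
pose s : R := a%:R `^ 2^-1.
have n1 : 1 <= cA by rewrite ler1n ltnW.
have aR : 0 < a%:R :> R by rewrite ltr0n.
have ss : s ^+ 2 = a%:R.
  by rewrite -powR_mulrn ?powR_ge0 // -powRrM mulVf // powRr1 // ltW.
have sR : 0 < s by rewrite powR_gt0.
have nra : cA <= r * a%:R.
  by rewrite -natrM ler_nat; apply: card_le_proj_mul.
have aa : a%:R ^+ 2 < C * cA.
  by apply: le_lt_trans hA; rewrite -natrX ler_nat card_fibre_square.
(* The sum of [A] and its richest fibre has at least [a] points for each line that
   meets [A]. *)
have raC : r * a%:R <= C ^+ 2 * cA.
  have A'0 : A' != fset0 by rewrite -cardfs_gt0 cA' ltnW.
  have := plunnecke_ruzsa 2 0 A'0 hA'; rewrite cA'; apply: le_trans.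
  rewrite -natrM ler_nat /mulfs /= addfs0.
  have -> : oppfs [fset 0]%fset = [fset 0]%fset :> {fset 'rV[R]_2}.
    by apply/fsetP => x; rewrite oppfsP !in_fset1 oppr_eq0.
  rewrite addfs0; apply: leq_trans (card_proj_mul (phi := phi) (c := c1) _ _) _.
    by move=> x; rewrite in_fibre => /andP[_ /eqP].
  by apply/fsubset_leq_card/addfsS/fibre_sub.
(* The fibres outside [S] have fewer than [s = sqrt a] points each. *)
have Br : #|` B|%:R <= r * s by apply: card_poor_le; [exact: ltW|rewrite ss].
have rK : r <= K * cA `^ (1 - delta).
  by apply: le_trans few _; rewrite ler_wpM2r ?powR_ge0 // lerDl.
have cAE : cA = #|` S|%:R + #|` B|%:R.
  by rewrite -natrD cardfsDS // subnKC // fsubset_leq_card.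
have [us Bw s2 Thalf] := rich_part_large hC K1 n1 aR (ler0n _ _) (ler0n _ _)
  (N0P _ nN) nra rK raC Br cAE.
pose T : R := #|` S|%:R; pose p : R := #|` proj phi S|%:R.
have S0 : S != fset0.
  rewrite -cardfs_gt0 -(ltr0n R) (lt_le_trans _ Thalf) // divr_gt0 //.
  exact: lt_le_trans ltr01 n1.
have pS0 : proj phi S != fset0 by rewrite proj_eq0.
have p1 : 1 <= p by rewrite ler1n cardfs_gt0.
have psT : 2 * p <= T.
  apply: le_trans (_ : p * s <= T); first by rewrite mulrC ler_wpM2l.
  by apply: card_rich_ge; [exact: ltW|rewrite ss].
have Tpa : T <= p * a%:R.
  rewrite -natrM ler_nat; apply: card_le_proj_mul => c.
  apply: leq_trans (amax c); apply/fsubset_leq_card/fsubsetP => x.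
  by rewrite !in_fibre => /andP[/(fsubsetP SA)-> ->].
have pK : p <= K * cA `^ (1 - sigma).
  apply: (le_trans (y := r)).
    rewrite ler_nat; apply/fsubset_leq_card/fsubsetP => c.
    by rewrite in_proj_rich => /andP[].
  apply: le_trans rK _; rewrite ler_wpM2l ?(le_trans ler01) //.
  by apply: ler_powR => //; rewrite lerD2l lerN2.
(* The second family of lines consists of the preimages under [L] of the lines along
   [v] that meet [S']. *)
pose S' := linimage L S.
pose q : R := #|` proj phi S'|%:R.
have cS' : #|` S'| = #|` S| by apply: card_linimage.
have pS'0 : proj phi S' != fset0 by rewrite proj_eq0 -cardfs_gt0 cS' cardfs_gt0.
have q1 : 1 <= q by rewrite ler1n cardfs_gt0.
have gs : (p + q - 1) * (q * T + p * T - p * q) <= p * q * cALA.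
  have := @grynkiewicz_serra _ _ phi (dot v) (@cross_dot_inj _ v ^~ v0) S S'.
  rewrite cS' => /le_trans; apply; apply: ler_wpM2l; first exact: mulr_ge0.
  rewrite ler_nat; apply/fsubset_leq_card/addfsS => //.
  by apply/fsubsetP => _ /imfsetP[x /= xS ->]; apply/in_linimage/(fsubsetP SA).
have [a_lt p_ge q_ge q_le main] := structure_bounds hC sigma2 n1 (ltW aR)
  (ler0n _ _) p1 q1 cAE Thalf psT Tpa aa hA Bw pK gs.
have [n1' [t1 [cp t1I t1P t1S]]] :=
  sorted_enumeration (fun c => #|` fibre phi A c|) pS0.
have [n2' [t2 [cq t2I t2P _]]] := sorted_enumeration (fun=> 0%N) pS'0.
pose phiL : {additive 'rV[R]_2 -> R} := cross v \o mulmxr L.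
have lS : [set` S] = (\bigcup_i [set x | cross v x = t1 i]) `&` [set` A].
  apply/seteqP; split=> x /=.
    move=> xS; split; last exact: (fsubsetP SA).
    by have /t1P[i tx] := mem_proj phi xS; exists i.
  move=> [[i _ /= xi] xA]; rewrite in_rich xA /= xi.
  have : t1 i \in proj phi S by apply/t1P; exists i.
  by rewrite in_proj_rich => /andP[].
have mS : [set` S] = (\bigcup_i [set x | cross v (x *m L) = t2 i]) `&` [set` S].
  apply/seteqP; split=> x /=; last by case.
  move=> xS; split=> //; have /t2P[i tx] := mem_proj phi (in_linimage L xS).
  by exists i.
have lpar : parallel_lines (fun i => [set x | cross v x = t1 i]).
  apply: (@levels_parallel _ phi v) => // [x|i]; first exact: cross_eq0.
  have /imfsetP[x _ ->] : t1 i \in proj phi S by apply/t1P; exists i.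
  by exists x.
have mpar : parallel_lines (fun i => [set x | cross v (x *m L) = t2 i]).
  apply: (@levels_parallel _ phiL (v *m invmx L)) => // [|x|i].
  - by apply: contraNneq v0 => E; rewrite -(mulmxKV Lu v) E mul0mx.
  - rewrite /= cross_eq0 //; split=> -[t E]; exists t.
      by rewrite -(mulmxK Lu x) E scalemxAl.
    by rewrite E -scalemxAl mulmxKV.
  have /imfsetP[y /= /imfsetP[x /= _ ->] ->] : t2 i \in proj phi S'.
    by apply/t2P; exists i.
  by exists x.
have top : #|` fibre phi A (t1 ord0)| = a.
  apply/eqP; rewrite eqn_leq amax /= {1}/a.
  have /t1P[i <-] : c1 \in proj phi S.
    by rewrite in_proj_rich c1A -/a -[leqLHS]expn1 leq_pexp2l.
  exact: t1S.
have pE : n1'.+1%:R = p by rewrite /p cp.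
have qE : n2'.+1%:R = q by rewrite /q cq.
exists S, B; split.
  split; last by apply/fdisjointP => x xS; rewrite in_fsetD xS.
  apply/fsetP => x; rewrite in_fsetU in_fsetD orb_andr orbN /=.
  by case: (boolP (x \in S)) => // /(fsubsetP SA)->.
exists n1', n2', (fun i => [set x | cross v x = t1 i]),
  (fun i => [set x | cross v (x *m L) = t2 i]).
rewrite /= !ncap_level -/phi top pE qE; split=> //.
- split=> //; apply: le_trans Bw _; rewrite ler_wpM2r ?powR_ge0 //.
  rewrite ler_wpM2l ?(le_trans ler01) //.
  have C2 : C <= 2 * C by rewrite ler_peMl ?ler1n // (le_trans ler01) // ltW.
  apply: (le_trans (y := (2 * C) ^+ 2)).
    by apply: lerXn2r; rewrite // nnegrE (le_trans ler01) ?ltW // (lt_le_trans hC).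
  by rewrite ler_weXn2l // (le_trans _ C2) // ltW.
- split=> // [i j ij| |].
  + by rewrite !ncap_level ler_nat; apply: t1S.
  + have : t1 ord_max \in proj phi S by apply/t1P; exists ord_max.
    rewrite in_proj_rich => /andP[_ ac].
    by rewrite -(@ler_pXn2r _ 2) ?nnegrE ?(ltW sR) // ss -natrX ler_nat.
  + by rewrite ler_pdivrMl // (lt_le_trans ltr01).
- by split=> //; apply: levels_not_parallel.
Qed.
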